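(* Let $F=(F_1,\dots,F_m)$ with $F_i=f_i+g_i$ be as in the context (with $f_i$ having Hölder continuous gradient on $\operatorname{dom}F$ with exponent $\nu_i\in(0,1]$ and coefficient $M_i>0$), and assume that each $f_i$ is convex. Let $\varepsilon>0$, $x^0\in\operatorname{dom}F$, $\ell_{-1}\ge2$, and let $\{x^k\}_{k\ge0}$ and $\{\ell_k\}_{k\ge-1}$ be generated by the backtracking proximal gradient method (Algorithm 1) described in the context. Let $X^*$ be the set of weakly Pareto optimal points of $F$, let $\Omega_F(\alpha)=\{x\in\mathbb{R}^n: F(x)\le\alpha\}$ (componentwise) for $\alpha\in\mathbb{R}^m$, and assume: (i) for every $x\in\Omega_F(F(x^0))$ there exists $x^*\in X^*$ such that $F(x^* )\le F(x)$ (componentwise); (ii) $\displaystyle R:=\sup_{F^*\in F(X^*\cap\Omega_F(F(x^0)))}\ \inf_{x\in F^{-1}(\{F^*\})}\|x-x^0\|^2<\infty$. Put $$N:=\max_{1\le i\le m}\left(\frac{1-\nu_i}{1+\nu_i}\cdot\frac1\varepsilon\right)^{\frac{1-\nu_i}{2\nu_i}}M_i^{\frac1{\nu_i}} .$$ If $K$ is a positive integer such that $$2K\ \ge\ \max\{\ell_{-1},2N\}\cdot\max\left\{4,\frac{2\sqrt{2R}}{\sqrt{\varepsilon}}\right\},$$ then $$\min_{0\le k\le 2K-1}\ell_k\,w_{\ell_k}(x^k)\le\varepsilon .$$ Moreover, with $\nu_{\min}=\min_{1\le i\le m}\nu_i$, the right-hand side of the lower bound on $2K$ is (for fixed problem data,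 $x^0$ and $\ell_{-1}$) of order $O\left(\varepsilon^{-\frac{1}{2\nu_{\min}}}\right)$ as $\varepsilon\downarrow0$.
   Context: Setting. Let $m,n\ge1$ be integers and $\|\cdot\|$ the Euclidean norm on $\mathbb{R}^n$. For $i=1,\dots,m$ let $F_i=f_i+g_i:\mathbb{R}^n\to\mathbb{R}\cup\{+\infty\}$, where $f_i:\mathbb{R}^n\to\mathbb{R}$ is continuously differentiable and $g_i:\mathbb{R}^n\to\mathbb{R}\cup\{+\infty\}$ is proper, lower semicontinuous and convex. Let $F=(F_1,\dots,F_m)$ and $\operatorname{dom}F=\{x\in\mathbb{R}^n: F_i(x)<+\infty\ \text{for all } i\}$, assumed nonempty (it is convex). For each $i$ there are $\nu_i\in(0,1]$ and $M_i>0$ with $\|\nabla f_i(x)-\nabla f_i(y)\|\le M_i\|x-y\|^{\nu_i}$ for all $x,y\in\operatorname{dom}F$. Convention: $0^0=1$, so that the $i$-th term in the definition of $N$ equals $M_i$ when $\nu_i=1$. A point $x^*\in\operatorname{dom}F$ is weakly Pareto optimal for $F$ if there is no $x\in\operatorname{dom}F$ with $F_i(x)<F_i(x^* )$ for all $i=1,\dots,m$. Merit function and search direction. For $\ell>0$ and $x\in\operatorname{dom}F$, $$w_\ell(x)=\max_{y\in\mathbb{R}^n}\left[\min_{1\le i\le m}\{\nabla f_i(x)^\top(x-y)+g_i(x)-g_i(y)\}-\frac{\ell}{2}\|y-x\|^2\right],$$ $$d_\ell(x)=\operatorname*{argmin}_{d\in\mathbb{R}^n}\left[\max_{1\le i\le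 m}\{\nabla f_i(x)^\top d+g_i(x+d)-g_i(x)\}+\frac{\ell}{2}\|d\|^2\right]$$ (the minimizer exists and is unique, and the minimum value equals $-w_\ell(x)$). Algorithm 1. Input: $x^0\in\operatorname{dom}F$, $\varepsilon>0$, $\ell_{-1}\ge2$. For $k=0,1,2,\dots$: the trial values of $\ell$ are, in order, $\ell=2^{j}\max\{1,\ell_{k-1}/2\}$, $j=0,1,2,\dots$. For each trial value $\ell$ put $d^k=d_\ell(x^k)$ and $x^{k+1}=x^k+d^k$, and test the condition $$F_i(x^{k+1})-F_i(x^k)\le -w_\ell(x^k)+\frac{\varepsilon}{2\ell}\quad\text{for all } i=1,\dots,m.$$ Stop at the first trial value $\ell$ for which the condition holds; set $\ell_k=\ell$, keep the corresponding $x^{k+1}=x^k+d_{\ell_k}(x^k)$, and go to the next $k$. *)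

(* Defs.v *)
From mathcomp Require Import all_boot all_order all_algebra.
From mathcomp Require Import all_classical all_reals all_analysis.
Set Implicit Arguments.
Unset Strict Implicit.
Unset Printing Implicit Defensive.
Import Order.TTheory GRing.Theory Num.Theory.
Import numFieldNormedType.Exports.
Local Open Scope classical_set_scope.
Local Open Scope ring_scope.

Section Euclidean.
Context {R : realType} {n : nat}.

Definition dot (u v : 'rV[R]_n) : R := \sum_(j < n) u 0 j * v 0 j.

(* The library norm `|v| on 'rV[R]_n is the sup norm, hence this definition;
   both induce the same topology. *)
Definition enorm (v : 'rV[R]_n) : R := Num.sqrt (dot v v).

Definition gradient (h : 'rV[R]_n -> R) (x : 'rV[R]_n) : 'rV[R]_n :=
  \row_(j < n) 'D_(delta_mx 0 j) h x.

Definition continuously_differentiable (h : 'rV[R]_n -> R) : Prop :=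
  (forall x, differentiable h x) /\ continuous (gradient h).

Definition proper_function (h : 'rV[R]_n -> \bar R) : Prop :=
  (forall x, h x != -oo%E) /\ (exists x, (h x < +oo)%E).

(* In \bar R, 0 * +oo = 0, so the cases t = 0 and t = 1 are harmless. *)
Definition econvex (h : 'rV[R]_n -> \bar R) : Prop :=
  forall (x y : 'rV[R]_n) (t : R), 0 <= t <= 1 ->
    (h (t *: x + (1 - t) *: y)%R <= t%:E * h x + (1 - t)%:E * h y)%E.

End Euclidean.

Section Problem.
Context {R : realType} {m n : nat}.
Variables (f : 'I_m -> 'rV[R]_n -> R) (g : 'I_m -> 'rV[R]_n -> \bar R).

Definition objective (x : 'rV[R]_n) (i : 'I_m) : \bar R :=
  ((f i x)%:E + g i x)%E.

Definition domain : set 'rV[R]_n :=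
  [set x | forall i, (objective x i < +oo)%E].

Definition weakly_pareto : set 'rV[R]_n :=
  [set xs | domain xs /\
    ~ exists2 x, domain x & forall i, (objective x i < objective xs i)%E].

Definition level_set (alpha : 'I_m -> \bar R) : set 'rV[R]_n :=
  [set x | forall i, (objective x i <= alpha i)%E].

(* For x in the domain, the only possibly infinite term below is g i y = +oo,
   so no indeterminate form arises. For such x and l > 0 the supremum over y
   is finite and attained. *)
Definition merit (l : R) (x : 'rV[R]_n) : \bar R :=
  ereal_sup [set (\big[mine/+oo]_(i < m)
                    ((dot (gradient (f i) x) (x - y)%R)%:E + g i x - g i y)
                  - (l / 2 * enorm (y - x)%R ^+ 2)%:E)%E | y in setT].

Definition subproblem (l : R) (x d : 'rV[R]_n) : \bar R :=
  (\big[maxe/-oo]_(i < m)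
     ((dot (gradient (f i) x) d)%:E + g i (x + d)%R - g i x)
   + (l / 2 * enorm d ^+ 2)%:E)%E.

(* The argmin: for x in the domain and l > 0 the set of minimizers is a
   singleton, and [xget] picks its element. *)
Definition direction (l : R) (x : 'rV[R]_n) : 'rV[R]_n :=
  xget 0 [set d | forall d', (subproblem l x d <= subproblem l x d')%E].

Definition trial (lprev : R) (j : nat) : R := 2 ^+ j * Num.max 1 (lprev / 2).

Definition accepted (eps : R) (x : 'rV[R]_n) (l : R) : Prop :=
  forall i, (objective (x + direction l x)%R i - objective x i
             <= - merit l x + (eps / (2 * l))%:E)%E.

(* [lm1] is the input l_{-1}, so that the sequence [l] starts at index 0. *)
Definition previous (lm1 : R) (l : nat -> R) (k : nat) : R :=
  if k is k'.+1 then l k' else lm1.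

Definition algorithm_run (eps : R) (x0 : 'rV[R]_n) (lm1 : R)
    (x : nat -> 'rV[R]_n) (l : nat -> R) : Prop :=
  x 0%N = x0 /\
  forall k, exists j : nat,
    [/\ l k = trial (previous lm1 l k) j,
        accepted eps (x k) (l k),
        forall j' : nat, (j' < j)%N ->
          ~ accepted eps (x k) (trial (previous lm1 l k) j') &
        x k.+1 = x k + direction (l k) (x k)].

Definition solution_radius (x0 : 'rV[R]_n) : \bar R :=
  ereal_sup
    [set ereal_inf [set (enorm (x - x0) ^+ 2)%:E |
                     x in objective @^-1` [set Fs]] |
      Fs in objective @` (weakly_pareto `&` level_set (objective x0))].

End Problem.

Section Constants.
Context {R : realType} {m : nat}.
Variables (nu M : 'I_m -> R).

(* [powR] satisfies 0 `^ 0 = 1; all terms are nonnegative, so starting the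
   maximum at 0 is harmless for m >= 1. *)
Definition bigN (eps : R) : R :=
  \big[Num.max/0]_(i < m)
    (((1 - nu i) / (1 + nu i) * (1 / eps)) `^ ((1 - nu i) / (2 * nu i))
     * M i `^ (1 / nu i)).

(* The exponents are at most 1, so starting the minimum at 1 is harmless. *)
Definition nu_min : R := \big[Num.min/1]_(i < m) nu i.

Definition iteration_bound (lm1 rad eps : R) : R :=
  Num.max lm1 (2 * bigN eps)
  * Num.max 4 (2 * Num.sqrt (2 * rad) / Num.sqrt eps).

End Constants.

(* Main.v *)
Require Import Defs.
From mathcomp Require Import all_boot all_order all_algebra.
From mathcomp Require Import all_classical all_reals all_analysis.
From mathcomp Require Import ring lra.
Set Implicit Arguments.
Unset Strict Implicit.
Unset Printing Implicit Defensive.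
Import Order.TTheory GRing.Theory Num.Theory.
Import numFieldNormedType.Exports.
Local Open Scope classical_set_scope.
Local Open Scope ring_scope.

(**
The proof rests on three estimates for an accepted proximal step
x -> x+ = x + d_l(x), where w = w_l(x):
- decrease: F_i(x+) <= F_i(x) - w + eps / (2 l) for all i, which is the
  acceptance test itself;
- three-point inequality: since x+ minimizes an l-strongly convex function and
  each f_i lies above its tangents, every y in the domain and every e with
  e <= F_i(x) - F_i(y) for all i satisfy
  e <= w + l / 2 (|y - x|^2 - |y - x+|^2) ([prox_step], [run_step]);
- step sizes: 1 <= l_k <= L := max(l_{-1}, 2 N).  Indeed, the Hoelder condition
  gives the descent inequality with remainder M / (1 + nu) |d|^(1 + nu)
  ([holder_descent]), and weighted AM-GM bounds this remainder by
  l / 2 |d|^2 + eps / (2 l) as soon as l is at least the i-th term of N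
  ([holder_young]); so every l >= N passes the test, and a backtracking step
  taken after a rejection ends below 2 N ([run_le]).

Suppose that l_k w_k > eps for all k < 2 K.  Then each step decreases every F_i
by at least w_k - eps / (2 l_k) > eps / (2 L).  Let y be a point with
F(y) <= F(x^{2K}), as provided by assumption (i).  The second half of the
iterations shows F_i(x^K) - F_i(y) >= Delta for all i, where Delta, the sum of
the decreases for K <= k < 2 K, exceeds K eps / (2 L).  In the first half the
gap to y before step k is therefore at least Delta + w_k - eps / (2 l_k), and
the three-point inequality, divided by l_k / 2, yields
(2 Delta - eps) / l_k <= |y - x^k|^2 - |y - x^{k+1}|^2 since l_k >= 1.  This
telescopes to S (2 Delta - eps) <= |y - x^0|^2, where S, the sum of the 1 / l_k
for k < K, is at least K / L ([two_phase_rate]).  The infimum over the y with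
the same value vector gives S (2 Delta - eps) <= R, while 2 L <= K gives
K^2 eps / (2 L^2) < S (2 Delta - eps) ([two_phase_gain]); this contradicts the
lower bound of 2 K in terms of sqrt (2 R / eps).

The minimizer d_l(x) exists although the g_i are only lower semicontinuous and
may take the value +oo.  The model is convex and vanishes at 0, so a lower bound -C on the unit ball
gives -C |d| outside of it, and the quadratic term dominates
([subproblem_sublevel_bounded]); a lower semicontinuous function attains its
minimum on a compact set ([lsc_attains_min]).

Extended reals are handled through epigraphs: subproblem <= a is equivalent to
finitely many inequalities g_i (x + d) <= (a real number)
([subproblem_leP]), and all later computations are real.

For the order of the bound, the i-th term of N is a constant times
eps^(-(1 - nu_i) / (2 nu_i)), the exponents are extremal for the smallest nu_i,
and the other factor contributes eps^(-1/2).
*)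

(** * Euclidean geometry and gradients *)

Section Euclid.
Context {R : realType} {n : nat}.
Implicit Types u v w : 'rV[R]_n.

Lemma dotC u v : dot u v = dot v u.
Proof. by apply: eq_bigr => j _; rewrite mulrC. Qed.

Lemma dotDl u v w : dot (u + v) w = dot u w + dot v w.
Proof. by rewrite -big_split; apply: eq_bigr => j _; rewrite mxE mulrDl. Qed.

Lemma dotZl a u w : dot (a *: u) w = a * dot u w.
Proof. by rewrite mulr_sumr; apply: eq_bigr => j _; rewrite mxE mulrA. Qed.

Lemma dotNl u w : dot (- u) w = - dot u w.
Proof. by rewrite -scaleN1r dotZl mulN1r. Qed.

Lemma dotDr u v w : dot u (v + w) = dot u v + dot u w.
Proof. by rewrite dotC dotDl !(dotC _ u). Qed.

Lemma dotZr a u w : dot u (a *: w) = a * dot u w.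
Proof. by rewrite dotC dotZl dotC. Qed.

Lemma dotNr u w : dot u (- w) = - dot u w.
Proof. by rewrite dotC dotNl dotC. Qed.

Lemma dot0r u : dot u 0 = 0.
Proof. by rewrite -(scale0r u) dotZr mul0r. Qed.

Definition dotE := (dotDl, dotDr, dotNl, dotNr, dotZl, dotZr).

Lemma dot_ge0 u : 0 <= dot u u.
Proof. by apply: sumr_ge0 => j _; rewrite -expr2 sqr_ge0. Qed.

Lemma enorm_ge0 u : 0 <= enorm u.
Proof. exact: sqrtr_ge0. Qed.

Lemma sqr_enorm u : enorm u ^+ 2 = dot u u.
Proof. by rewrite sqr_sqrtr // dot_ge0. Qed.

Lemma enorm0 : enorm (0 : 'rV[R]_n) = 0.
Proof.
by rewrite /enorm /dot big1 ?sqrtr0 // => j _; rewrite mxE mul0r.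
Qed.

Lemma enormN u : enorm (- u) = enorm u.
Proof. by rewrite /enorm !dotE opprK. Qed.

Lemma enormZ a u : enorm (a *: u) = `|a| * enorm u.
Proof. by rewrite /enorm !dotE mulrA -expr2 sqrtrM ?sqr_ge0 // sqrtr_sqr. Qed.

Lemma coord_le_enorm u j : `|u 0 j| <= enorm u.
Proof.
rewrite -sqrtr_sqr ler_sqrt ?dot_ge0 // /dot (bigD1 j) //= expr2 lerDl.
by apply: sumr_ge0 => k _; rewrite -expr2 sqr_ge0.
Qed.

(** The library norm of a row vector is the sup norm; this inequality
    transfers sup-norm coercivity estimates to the Euclidean norm. *)
Lemma norm_le_enorm u : `|u| <= enorm u.
Proof.
rewrite [leLHS]/(Num.norm u) /= mx_normrE; apply/bigmax_leP; split.
  exact: enorm_ge0.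
by move=> [i j] _ /=; rewrite (ord1 i); exact: coord_le_enorm.
Qed.

Lemma enorm_eq0 u : enorm u = 0 -> u = 0.
Proof.
by move=> u0; apply/eqP; rewrite -normr_le0 -u0 norm_le_enorm.
Qed.

Lemma dot_le_enorm u v : dot u v <= enorm u * enorm v.
Proof.
have [->|u0] := eqVneq u 0.
  by rewrite dotC dot0r mulr_ge0 ?enorm_ge0.
have [->|v0] := eqVneq v 0.
  by rewrite dot0r mulr_ge0 ?enorm_ge0.
have enorm_gt0 w : w != 0 -> 0 < enorm w.
  move=> w0; rewrite lt0r enorm_ge0 andbT.
  by apply: contra_neq w0; exact: enorm_eq0.
have := dot_ge0 (enorm v *: u - enorm u *: v).
rewrite !dotE -!sqr_enorm (dotC v u) => H.
have ab0 : 0 < enorm u * enorm v by rewrite mulr_gt0 ?enorm_gt0.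
rewrite -(ler_pM2l ab0); nra.
Qed.

(** The last term is what turns minimality into the three-point inequality of
    [prox_step]. *)
Lemma sqr_enorm_conv u v t :
  enorm (u + t *: (v - u)) ^+ 2 =
  (1 - t) * enorm u ^+ 2 + t * enorm v ^+ 2
  - t * (1 - t) * enorm (v - u) ^+ 2.
Proof. rewrite !sqr_enorm !dotE (dotC v u); ring. Qed.

Lemma sum_continuous (F : 'I_n -> 'rV[R]_n -> R) :
  (forall j, continuous (F j)) -> continuous (fun u => \sum_j F j u).
Proof.
have add_cont : continuous (fun z : R * R => z.1 + z.2).
  exact: pseudometric_normed_Zmodule.add_continuous.
by move=> cF; apply: (@continuous_big R 'I_n +%R 0 xpredT add_cont).
Qed.

Lemma dot_continuous u : continuous (dot u).
Proof.
apply: (@sum_continuous (fun j v => u 0 j * v 0 j)) => j v.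
by apply: continuousM; [exact: cst_continuous|exact: coord_continuous].
Qed.

Lemma sqr_enorm_continuous : continuous (fun u => enorm u ^+ 2).
Proof.
under eq_fun do rewrite sqr_enorm.
apply: (@sum_continuous (fun j v => v 0 j * v 0 j)) => j v.
by apply: continuousM; exact: coord_continuous.
Qed.

Lemma derive_dot_gradient (h : 'rV[R]_n -> R) x v :
  differentiable h x -> 'D_v h x = dot (gradient h x) v.
Proof.
move=> dh; rewrite deriveE // {1}(row_sum_delta v) raddf_sum.
apply: eq_bigr => j _. rewrite mxE deriveE // mulrC; exact: linearZ.
Qed.

(** The difference quotients of the restriction to the line are those of h at
    x + t v in the direction v. *)
Lemma is_derive_line (h : 'rV[R]_n -> R) x v (t : R) :
  (forall y, differentiable h y) ->
  is_derive t 1 (fun s => h (x + s *: v)) (dot (gradient h (x + t *: v)) v).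
Proof.
move=> dh.
have quotE :
    (fun s : R => s^-1 *: (h (x + (s *: 1 + t) *: v) - h (x + t *: v)))
    = (fun s => s^-1 *: (h (s *: v + (x + t *: v)) - h (x + t *: v))).
  by apply/funext => s; rewrite [s *: 1]mulr1 scalerDl addrCA.
split.
  by rewrite /derivable quotE; exact: diff_derivable.
by rewrite -derive_dot_gradient // /derive quotE.
Qed.

(** The difference quotients of h from x towards y are at most h y - h x by
    convexity; the gradient term is their limit. *)
Lemma convex_above_tangent (h : 'rV[R]_n -> R) x y :
  convex_function (setT : set (convex_lmodType 'rV[R]_n)) h ->
  differentiable h x ->
  dot (gradient h x) (y - x) <= h y - h x.
Proof.
move=> ch dh; rewrite -derive_dot_gradient //.
have dv : derivable h x (y - x) by exact: diff_derivable.
apply: (cvgr_to_le (cvg_dnbhs_at_right dv)); near=> t.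
have t0 : 0 < t by near: t; exact: nbhs_right_gt.
have t1 : t <= 1 by near: t; apply: nbhs_right_le.
have /= := ch (Itv01 (ltW t0) t1) y x (mem_set I) (mem_set I).
rewrite convRE /= /conv /= /unstable.onem => H.
rewrite [_ *: _]mulrC ler_pdivrMr //.
suff -> : t *: (y - x) + x = t *: y + (1 - t) *: x by lra.
by rewrite scalerBr scalerBl scale1r addrAC addrA.
Unshelve. all: by end_near. Qed.
Lemma compact_norm_ball (r : R) : compact [set u : 'rV[R]_n | `|u| <= r].
Proof.
apply: bounded_closed_compact.
  exists r; split; first exact: num_real.
  by move=> s rs u /= ur; exact: le_trans ur (ltW rs).
apply: (@preimage_closed _ _ (fun u : 'rV[R]_n => `|u|) [set s | s <= r]).
  by move=> u _; exact: norm_continuous.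
exact: closed_le.
Qed.

End Euclid.

(** * Hoelder descent inequality *)

Section Descent.
Context {R : realType} {n : nat}.

Lemma is_derive_powR (p t : R) : 0 < t ->
  is_derive t 1 (fun s => s `^ p) (p * t `^ (p - 1)).
Proof.
move=> t0; have t0' : t \in `]0, +oo[ by rewrite in_itv /= t0.
split; first exact: derivable_powR.
by rewrite -derive1E powR_derive1.
Qed.

Lemma continuous_powR (p t : R) : 0 < t ->
  {for t, continuous (fun s : R => s `^ p)}.
Proof.
move=> t0; apply: differentiable_continuous; apply/derivable1_diffP.
by have [] := is_derive_powR p t0.
Qed.

(** Only one-sided continuity holds at 0: the library power of a negative
    number is 1. *)
Lemma within_continuous_powR (p : R) : 0 < p ->
  {within `[0, 1], continuous (fun s : R => s `^ p)}.
Proof.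
move=> p0; apply/continuous_within_itvP => //; split.
- by move=> t; rewrite in_itv /= => /andP[t0 _]; exact: continuous_powR.
- by rewrite powR0 ?gt_eqF //; exact: powR_cvg0.
- by apply: cvg_at_left_filter; exact: continuous_powR.
Qed.

(** Subtracting the linear part and the power M / (1 + nu) |v|^(1 + nu) t^(1
    + nu) from h along the segment leaves a function of t whose derivative is
    nonpositive by Cauchy-Schwarz, and the mean value theorem applies to it. *)
Lemma holder_descent (h : 'rV[R]_n -> R) (x v : 'rV[R]_n) (M nu : R) :
  (forall y, differentiable h y) -> 0 < nu ->
  (forall t : R, 0 < t < 1 ->
     enorm (gradient h (x + t *: v) - gradient h x)
       <= M * enorm (t *: v) `^ nu) ->
  h (x + v) - h x <=
    dot (gradient h x) v + M / (1 + nu) * enorm v `^ (1 + nu).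
Proof.
move=> dh nu0 hol.
set c := enorm v `^ (1 + nu); have v0 := enorm_ge0 v.
have p0 : 0 < 1 + nu by rewrite addr_gt0.
pose phi (t : R) := h (x + t *: v) - t * dot (gradient h x) v
  - M / (1 + nu) * c * t `^ (1 + nu).
pose dphi (t : R) := dot (gradient h (x + t *: v)) v - dot (gradient h x) v
  - M * c * t `^ nu.
have dline (t : R) := is_derive_line x v t dh.
have dphiP (t : R) : t \in `]0, 1[ -> is_derive t 1 phi (dphi t).
  rewrite in_itv /= => /andP[t0 _].
  have dp := is_derive_powR (1 + nu) t0.
  apply: is_derive_eq.
  rewrite /dphi /GRing.scale /=.
  rewrite [1 + nu - 1]addrAC subrr add0r.
  field; exact: lt0r_neq0.
have cphi : {within `[0, 1], continuous phi}.
  apply: within_continuousB.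
    have cl : continuous
        (fun s : R => h (x + s *: v) - s * dot (gradient h x) v).
      by move=> s; apply: differentiable_continuous; apply/derivable1_diffP.
    exact: (continuous_subspaceT cl).
  move=> t; apply: cvgMl_tmp.
  exact: (within_continuous_powR p0).
have [t t01 mvt] := MVT ltr01 dphiP cphi.
suff : dphi t <= 0.
  move: mvt; rewrite /phi scale1r scale0r addr0 powR1 powR0 ?gt_eqF //; lra.
move: t01; rewrite in_itv /= => /andP[t0 t1].
rewrite subr_le0 -dotNl -dotDl (le_trans (dot_le_enorm _ _)) //.
have := hol t; rewrite t0 t1 => /(_ isT) holt.
rewrite (le_trans (ler_wpM2r v0 holt)) // enormZ gtr0_norm //.
rewrite powRM ?(ltW t0) // /c powRD; last by rewrite gt_eqF.
by rewrite powRr1 // le_eqVlt; apply/orP; left; apply/eqP; ring.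
Qed.

End Descent.

(** * Absorbing the Hoelder remainder *)

Section Young.
Context {R : realType}.

Definition holder_threshold (nu M eps : R) : R :=
  ((1 - nu) / (1 + nu) * (1 / eps)) `^ ((1 - nu) / (2 * nu)) * M `^ (1 / nu).

(** For nu < 1 this is weighted AM-GM with weights (1 + nu) / 2 and
    (1 - nu) / 2 applied to multiples of t^2 and of eps / l; the threshold is
    the value of l for which the resulting coefficient of t^(1 + nu) is
    exactly M / (1 + nu). *)
Lemma holder_young (nu M eps l t : R) :
  0 < nu <= 1 -> 0 < M -> 0 < eps -> 0 < l -> 0 <= t ->
  holder_threshold nu M eps <= l ->
  M / (1 + nu) * t `^ (1 + nu) <= l / 2 * t ^+ 2 + eps / (2 * l).
Proof.
move=> /andP[nu0]; rewrite le_eqVlt => /predU1P[->|nu1] M0 e0 l0 t0.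
  rewrite /holder_threshold subrr !mul0r powRr0 mul1r divr1.
  rewrite powRr1 ?(ltW M0) // => Ml.
  have -> : t `^ (1 + 1) = t ^+ 2 by rewrite -powR_mulrn.
  have eps_term : 0 <= eps / (2 * l) by rewrite divr_ge0 ?mulr_ge0 // ltW.
  have := ler_wpM2r (sqr_ge0 t) Ml; rewrite -[1 + 1]/(2%:R); lra.
move=> Nl.
have nup0 : 0 < 1 + nu by lra.
have num0 : 0 < 1 - nu by lra.
set th := (1 + nu) / 2; set om := (1 - nu) / 2.
have th0 : 0 < th by rewrite /th; lra.
have om0 : 0 < om by rewrite /om; lra.
set a := l / (1 + nu); set b := eps / (l * (1 - nu)).
have a0 : 0 < a by rewrite divr_gt0.
have b0 : 0 < b by rewrite divr_gt0 // mulr_gt0.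
(* a and b are chosen so that the weighted arithmetic mean with weights th and
   om = 1 - th is exactly the right-hand side. *)
have amgm : (a * t ^+ 2) `^ th * b `^ om <= th * (a * t ^+ 2) + om * b.
  have := @conjugate_powR R ((a * t ^+ 2) `^ th) (b `^ om) th^-1 om^-1
    (powR_ge0 _ _) (powR_ge0 _ _).
  rewrite !invr_gt0 !invrK => /(_ th0 om0).
  rewrite -!powRrM !divff ?gt_eqF // !powRr1 ?(ltW b0) //; last first.
    by rewrite mulr_ge0 ?sqr_ge0 // ltW.
  rewrite [_ * th]mulrC [_ * om]mulrC; apply.
  by rewrite /th /om; field.
have -> : l / 2 * t ^+ 2 + eps / (2 * l) = th * (a * t ^+ 2) + om * b.
  by rewrite /th /om /a /b; field; rewrite !gt_eqF.
apply: le_trans amgm.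
rewrite powRM ?(ltW a0) ?sqr_ge0 // -powR_mulrn // -powRrM.
have -> : 2%:R * th = 1 + nu by rewrite /th; field.
rewrite [leRHS]mulrAC ler_wpM2r ?powR_ge0 //.
(* After taking logarithms, the goal is nu times the hypothesis on l. *)
have ip0 : 0 < (1 + nu)^-1 by rewrite invr_gt0.
have im0 : 0 < (l * (1 - nu))^-1 by rewrite invr_gt0 mulr_gt0.
have lm0 : 0 < l * (1 - nu) by rewrite mulr_gt0.
have ie0 : 0 < 1 / eps by rewrite divr_gt0.
have c0 : 0 < (1 - nu) / (1 + nu) by rewrite divr_gt0.
have ce0 : 0 < (1 - nu) / (1 + nu) * (1 / eps) by rewrite mulr_gt0.
have N0 : 0 < holder_threshold nu M eps by rewrite mulr_gt0 ?powR_gt0.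
rewrite -ler_ln ?posrE ?mulr_gt0 ?powR_gt0 //.
have := Nl; rewrite -ler_ln ?posrE // /holder_threshold.
rewrite !lnM ?posrE ?powR_gt0 ?invr_gt0 //.
rewrite !ln_powR /a /b !lnM ?posrE ?invr_gt0 //.
rewrite !lnV ?posrE // lnM ?posrE // ln1.
set lp := ln (1 + nu); set lm := ln (1 - nu); set lM := ln M.
set le := ln eps; set ll := ln l => ler_ll.
have := ler_wpM2l (ltW nu0) ler_ll; rewrite /th /om.
have -> : nu * ((1 - nu) / (2 * nu) * (lm - lp + (0 - le)) + 1 / nu * lM)
    = (1 - nu) / 2 * (lm - lp - le) + lM.
  by field; rewrite gt_eqF.
lra.
Qed.

End Young.

(** * Lower semicontinuous functions on compact sets *)

Section Semicontinuity.
Context {R : realType}.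

(** The parts of A where h <= h y, for y in A, form a filter base because the
    extended reals are totally ordered; lower semicontinuity puts each
    cluster point of that filter in all of them. *)
Lemma lsc_attains_min (T : topologicalType) (A : set T) (h : T -> \bar R) :
  compact A -> A !=set0 -> lower_semicontinuous h ->
  exists2 p, A p & forall y, A y -> (h p <= h y)%E.
Proof.
move=> cA [y0 Ay0] lsch.
pose F := filter_from A (fun y => A `&` [set z | (h z <= h y)%E]).
have FF : ProperFilter F.
  apply: filter_from_proper; last by move=> y Ay; exists y; split => /=.
  apply: filter_from_filter; first by exists y0.
  move=> y z Ay Az; case: (leP (h y) (h z)) => [yz|/ltW zy].
    by exists y => // w [Aw wy]; split; split => //=; exact: le_trans yz.
  by exists z => // w [Aw wz]; split; split => //=; exact: le_trans zy.
have FA : F A by exists y0 => // z [].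
have [p [Ap clp]] := cA F FF FA.
exists p => // y Ay; rewrite leNgt; apply/negP => hyp.
have [a ya ap] : exists2 a : R, (h y <= a%:E)%E & (a%:E < h p)%E.
  case: (h y) hyp => [r rp||]; first by [exists r]; first by rewrite ltNge leey.
  case: (h p) => [r _|_|//]; last by exists 0; rewrite ?leNye ?ltry.
  by exists (r - 1); rewrite ?leNye // lte_fin ltrBlDr ltrDl.
have [V pV Va] := lsch p a ap.
have FB : F (A `&` [set z | (h z <= h y)%E]) by exists y.
have [z [[_ hzy] /Va]] := clp _ _ FB pV.
by rewrite ltNge (le_trans hzy ya).
Qed.

End Semicontinuity.

(** * The proximal subproblem *)

Section Subproblem.
Context {R : realType} {m n : nat}.
Variables (f : 'I_m -> 'rV[R]_n -> R) (g : 'I_m -> 'rV[R]_n -> \bar R).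
Hypothesis g_proper : forall i, proper_function (g i).
Hypothesis g_lsc : forall i, lower_semicontinuous (g i).
Hypothesis g_convex : forall i, econvex (g i).
Implicit Types (x y d : 'rV[R]_n) (l a b c t : R).

Lemma gNy i x : g i x != -oo%E. Proof. by have [+ _] := g_proper i; exact. Qed.

Lemma domainP x : domain f g x <-> forall i, (g i x < +oo)%E.
Proof.
by split=> H i; have := H i; have := gNy i x; rewrite /objective;
  case: (g i x) => [r||]; rewrite ?ltry.
Qed.

Lemma domain_fine x i : domain f g x -> g i x = (fine (g i x))%:E.
Proof.
move=> /domainP /(_ i) gx; rewrite fineK // fin_numE gNy /=.
by rewrite lt_eqF.
Qed.

Lemma econvex_le i x y a b t : 0 <= t <= 1 ->
  (g i x <= a%:E)%E -> (g i y <= b%:E)%E ->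
  (g i (t *: x + (1 - t) *: y) <= (t * a + (1 - t) * b)%:E)%E.
Proof.
move=> t01 xa yb; apply: le_trans (g_convex i x y t01) _.
have /andP[t0 t1] := t01.
by rewrite [leRHS]EFinD !EFinM leeD // lee_wpmul2l // lee_fin ?subr_ge0.
Qed.

(** The epigraph form removes the only possibly infinite quantity, g i (x +
    d), from the arithmetic. *)
Lemma subproblem_leP l x d a : domain f g x ->
  (subproblem f g l x d <= a%:E)%E <->
  forall i, (g i (x + d) <=
    (a - l / 2 * enorm d ^+ 2 - dot (gradient (f i) x) d + fine (g i x))%:E)%E.
Proof.
move=> Dx; rewrite /subproblem -leeBrDr //.
rewrite -[(a%:E - _)%E]/((a - l / 2 * enorm d ^+ 2)%:E).
set q := a - _.
have E i : ((dot (gradient (f i) x) d)%:E + g i (x + d) - g i x <= q%:E)%E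
    = (g i (x + d) <= (q - dot (gradient (f i) x) d + fine (g i x))%:E)%E.
  rewrite {1}(domain_fine i Dx); have := gNy i (x + d).
  by case: (g i (x + d)) => //= r _; rewrite -!EFinD !lee_fin; lra.
split=> [/bigmax_leP[_ H] i|H]; first by rewrite -E; exact: H.
by apply/bigmax_leP; split => [|i _]; rewrite ?leNye // E; exact: H.
Qed.

Lemma subproblem0_le0 l x : domain f g x -> (subproblem f g l x 0 <= 0%:E)%E.
Proof.
move=> Dx; apply/subproblem_leP => // i.
rewrite addr0 enorm0 expr0n /= mulr0 dot0r !subr0 add0r.
by rewrite -domain_fine.
Qed.

Lemma subproblem_domain l x d a : domain f g x ->
  (subproblem f g l x d <= a%:E)%E -> domain f g (x + d).
Proof.
move=> Dx /subproblem_leP -/(_ Dx) H; apply/domainP => i.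
by apply: le_lt_trans (H i) _; rewrite ltry.
Qed.

(** The strong convexity has modulus l; it also serves with l = 0, where only
    convexity is left. *)
Lemma subproblem_convex l x d d' a b t : domain f g x -> 0 <= t <= 1 ->
  (subproblem f g l x d <= a%:E)%E -> (subproblem f g l x d' <= b%:E)%E ->
  (subproblem f g l x (d + t *: (d' - d)) <=
    ((1 - t) * a + t * b - l / 2 * (t * (1 - t)) * enorm (d' - d) ^+ 2)%:E)%E.
Proof.
move=> Dx t01 /subproblem_leP -/(_ Dx) da /subproblem_leP -/(_ Dx) d'b.
apply/subproblem_leP => // i.
have -> : x + (d + t *: (d' - d)) = t *: (x + d') + (1 - t) *: (x + d).
  by apply/rowP => j; rewrite !mxE; ring.
apply: le_trans (econvex_le t01 (d'b i) (da i)) _.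
by rewrite lee_fin sqr_enorm_conv !dotE; lra.
Qed.

(** A strict inequality a < subproblem fails the epigraph condition for some
    i, which compares the lower semicontinuous g i (x + d) with a continuous
    function of d; a real number strictly between the two survives near d. *)
Lemma subproblem_lsc l x : domain f g x ->
  lower_semicontinuous (subproblem f g l x).
Proof.
move=> Dx d a; rewrite ltNge => /negP ad.
have [i] : exists i, ~ (g i (x + d) <=
    (a - l / 2 * enorm d ^+ 2 - dot (gradient (f i) x) d + fine (g i x))%:E)%E.
  by apply/existsNP => H; apply: ad; apply/subproblem_leP.
move/negP; rewrite -ltNge.
pose q e := a - l / 2 * enorm e ^+ 2 - dot (gradient (f i) x) e + fine (g i x).
rewrite -/(q d) => qd.
have [s qs sg] : exists2 s : R, q d < s & (s%:E < g i (x + d))%E.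
  case: (g i (x + d)) qd => [r|_|//].
    rewrite lte_fin => qr; exists ((q d + r) / 2); rewrite ?lte_fin; lra.
  by exists (q d + 1); rewrite ?ltry // ltrDl.
have cq : continuous q.
  move=> e.
  have -> : q = cst a \- (fun e => l / 2 * enorm e ^+ 2)
      \- dot (gradient (f i) x) \+ cst (fine (g i x)) by [].
  apply: continuousD; last exact: cst_continuous.
  apply: continuousB; last exact: dot_continuous.
  apply: continuousB; first exact: cst_continuous.
  apply: continuousM; first exact: cst_continuous.
  exact: sqr_enorm_continuous.
have [V xdV Vs] := g_lsc sg.
exists ([set e | V (x + e)] `&` [set e | q e < s]).
  apply: filterI; last exact: (cvgr_lt _ (cq d)).
  have cx : (fun e => x + e) @ d --> x + d.
    by apply: continuousD; [exact: cst_continuous|].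
  exact: cx.
move=> e [/Vs gs qes]; rewrite ltNge; apply/negP => /subproblem_leP -/(_ Dx).
move=> /(_ i); rewrite -/(q e); apply/negP; rewrite -ltNge.
by apply: lt_trans gs; rewrite lte_fin.
Qed.

Hypothesis m_gt0 : (0 < m)%N.

Lemma subproblemNy l x d : domain f g x -> subproblem f g l x d != -oo%E.
Proof.
move=> Dx; apply/negP => /eqP H.
have i0 : 'I_m := Ordinal m_gt0.
have := gNy i0 (x + d).
pose q := - l / 2 * enorm d ^+ 2 - dot (gradient (f i0) x) d + fine (g i0 x).
have qa a : (subproblem f g l x d <= a%:E)%E by rewrite H leNye.
have {}qa a : (g i0 (x + d) <= a%:E)%E.
  have /subproblem_leP -/(_ Dx i0) := qa (a - q).
  by congr (_ <= _%:E)%E; rewrite /q; ring.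
case: (g i0 (x + d)) qa => // [r /(_ (r - 1))|/(_ 0) //].
by rewrite lee_fin; lra.
Qed.

(** Without the quadratic term the model is still lower semicontinuous, hence
    bounded below on the compact unit ball. *)
Lemma subproblem_bounded x : domain f g x ->
  exists C : R, forall u, `|u| <= 1 -> ((- C)%:E <= subproblem f g 0 x u)%E.
Proof.
move=> Dx; have [|p _ pmin] := lsc_attains_min (@compact_norm_ball R n 1) _
  (@subproblem_lsc 0 x Dx).
  by exists 0 => /=; rewrite normr0.
have := subproblemNy 0 p Dx; case E : (subproblem f g 0 x p) => [r||] // _.
  by exists (- r) => u u1; rewrite opprK -E; exact: pmin.
by exists 0 => u u1; apply: le_trans (pmin u u1); rewrite E leey.
Qed.

(** For |d| > 1 convexity between 0 and d, applied to the model without its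
    quadratic term, moves the lower bound -C at d / |d| to -C |d| at d; where
    the subproblem is at most 0 that value is also at most - l / 2 |d|^2, so
    |d| <= 2 C / l.  Here |d| is the sup norm, below the Euclidean one. *)
Lemma subproblem_sublevel_bounded l x : 0 < l -> domain f g x ->
  exists B : R, forall d, (subproblem f g l x d <= 0%:E)%E -> `|d| <= B.
Proof.
move=> l0 Dx; have [C HC] := subproblem_bounded Dx.
exists (Num.max 1 (2 * C / l)) => d d0; rewrite le_max.
case: (leP `|d| 1) => //= d1.
have dp : 0 < `|d| by apply: lt_trans d1.
have ds : (subproblem f g 0 x d <= (- (l / 2 * enorm d ^+ 2))%:E)%E.
  apply/subproblem_leP => // i; move/subproblem_leP: d0 => /(_ Dx i).
  by congr (_ <= _%:E)%E; ring.
have t01 : 0 <= (`|d|)^-1 <= 1 by rewrite invr_ge0 normr_ge0 invf_le1 // ltW.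
have := subproblem_convex Dx t01 (subproblem0_le0 0 Dx) ds.
rewrite add0r subr0 => H.
have u1 : `| (`|d|)^-1 *: d | <= 1.
  by rewrite normrZ ger0_norm ?invr_ge0 // mulVf // gt_eqF.
have := le_trans (HC _ u1) H.
rewrite mulr0 add0r !mul0r subr0 lee_fin mulrN lerN2 => K.
have sq : `|d| ^+ 2 <= enorm d ^+ 2.
  by rewrite ler_pXn2r ?nnegrE ?enorm_ge0 // norm_le_enorm.
have : (`|d|)^-1 * (l / 2 * `|d| ^+ 2) <= C.
  by apply: le_trans K; rewrite ler_pM2l ?invr_gt0 // ler_pM2l // divr_gt0.
have -> : (`|d|)^-1 * (l / 2 * `|d| ^+ 2) = l / 2 * `|d|.
  by field; rewrite gt_eqF.
by move=> H2; rewrite ler_pdivlMr //; lra.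
Qed.

Lemma subproblem_has_min l x : 0 < l -> domain f g x ->
  exists d, forall d', (subproblem f g l x d <= subproblem f g l x d')%E.
Proof.
move=> l0 Dx; have [B HB] := subproblem_sublevel_bounded l0 Dx.
have s0 := subproblem0_le0 l Dx.
have [|p _ pmin] := lsc_attains_min (@compact_norm_ball R n B) _
  (@subproblem_lsc l x Dx).
  by exists 0; exact: HB.
exists p => d; case: (leP `|d| B) => [dB|]; first exact: pmin.
rewrite ltNge => /negP dB; apply: (@le_trans _ _ 0%:E).
  by apply: (le_trans _ s0); apply: pmin; exact: (HB _ s0).
by rewrite leNgt; apply/negP => /ltW /HB /dB.
Qed.

Lemma direction_min l x d : 0 < l -> domain f g x ->
  (subproblem f g l x (direction f g l x) <= subproblem f g l x d)%E.
Proof.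
move=> l0 Dx; have [d0 d0min] := subproblem_has_min l0 Dx.
have /= := @xgetPex _ 0
  [set d | forall d', (subproblem f g l x d <= subproblem f g l x d')%E]
  (ex_intro _ d0 d0min).
exact.
Qed.

(** Under y = x + d the maximand of the merit function is the opposite of the
    subproblem. *)
Lemma merit_subproblem l x : 0 < l -> domain f g x ->
  merit f g l x = (- subproblem f g l x (direction f g l x))%E.
Proof.
move=> l0 Dx.
have E y : (\big[mine/+oo]_(i < m)
      ((dot (gradient (f i) x) (x - y)%R)%:E + g i x - g i y)
    - (l / 2 * enorm (y - x)%R ^+ 2)%:E)%E = (- subproblem f g l x (y - x))%E.
  rewrite /subproblem oppeD ?fin_num_adde_defl //; congr (_ - _)%E.
  rewrite (big_morph _ oppe_max (erefl : (- -oo)%E = +oo%E)).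
  apply: eq_bigr => i _; rewrite (addrC x (y - x)) subrK -(opprB y x) dotNr.
  rewrite (domain_fine i Dx); have := gNy i y.
  by case: (g i y) => // r _ /=; congr _%:E; ring.
apply/eqP; rewrite eq_le; apply/andP; split.
  apply: ge_ereal_sup => _ [y _ <-]; rewrite E leeN2.
  exact: direction_min.
apply: ereal_sup_ubound; exists (x + direction f g l x) => //.
by rewrite E addrC addKr.
Qed.

(** The last clause is the three-point inequality. Comparing the minimizer p
    with the points p + t (d - p) and dividing by t gives it with the factor
    1 - t in front of the squared distance; then t tends to 0. *)
Lemma prox_step l x : 0 < l -> domain f g x ->
  exists v : R, [/\ merit f g l x = v%:E,
    (subproblem f g l x (direction f g l x) <= (- v)%:E)%E &
    forall d c, (subproblem f g l x d <= c%:E)%E ->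
      - v + l / 2 * enorm (d - direction f g l x) ^+ 2 <= c].
Proof.
move=> l0 Dx; have mE := merit_subproblem l0 Dx.
have dmin d := direction_min d l0 Dx.
set p := direction f g l x in mE dmin *.
have p0 := le_trans (dmin 0) (subproblem0_le0 l Dx).
have := subproblemNy l p Dx.
case sE : (subproblem f g l x p) p0 => [r|//|//] r0 _.
exists (- r); split; rewrite ?opprK //; first by rewrite mE sE.
move=> d c dc; set D := _ * _.
have step t : 0 < t < 1 -> r + (1 - t) * D <= c.
  move=> /andP[t0 t1]; have t01 : 0 <= t <= 1 by rewrite !ltW.
  have pr : (subproblem f g l x p <= r%:E)%E by rewrite sE.
  have := le_trans (dmin _) (subproblem_convex Dx t01 pr dc).
  rewrite sE lee_fin => H; rewrite -(ler_pM2l t0) /D; lra.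
rewrite -lerBrDl; apply/ler_addgt0Pr => e e0.
have D0 : 0 <= D by rewrite mulr_ge0 ?sqr_ge0 // divr_ge0 // ltW.
pose t := e / (1 + D + e).
have den : 0 < 1 + D + e by lra.
have t0 : 0 < t by rewrite divr_gt0.
have t1 : t < 1 by rewrite ltr_pdivrMr //; lra.
have := step t; rewrite t0 t1 => /(_ isT).
have : t * D <= e; last by lra.
by rewrite /t mulrAC ler_pdivrMr //; nra.
Qed.

End Subproblem.

(** * Two-phase telescoping argument *)

Section Rate.
Context {R : realType} {I : Type}.

(** The abstract form of the argument: r k stands for |y - x^k|^2, F k i for
    F_i(x^k) and v k for the merit value. The decreases of the second half
    bound the gap to y from below throughout the first half, where the
    proximal inequalities telescope. *)
Lemma two_phase_rate (K : nat) (l v r : nat -> R) (F : nat -> I -> R)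
    (Fy : I -> R) (eps : R) :
  0 < eps ->
  (forall k, (k < 2 * K)%N -> 1 <= l k) ->
  (forall k, (k < 2 * K)%N -> eps < l k * v k) ->
  (forall k i, (k < 2 * K)%N -> F k.+1 i <= F k i - v k + eps / (2 * l k)) ->
  (forall i, Fy i <= F (2 * K)%N i) ->
  (forall k e, (k < 2 * K)%N -> (forall i, e <= F k i - Fy i) ->
     e <= v k + l k / 2 * (r k - r k.+1)) ->
  0 <= r K ->
  (\sum_(0 <= k < K) (l k)^-1) *
    (2 * (\sum_(K <= k < 2 * K) (v k - eps / (2 * l k))) - eps) <= r 0%N.
Proof.
move=> e0 l1 lv desc below prox rK; set D := \sum_(K <= k < 2 * K) _.
have K2 : (K <= 2 * K)%N by rewrite leq_pmull.
have l0 k : (k < 2 * K)%N -> 0 < l k by move=> /l1; apply: lt_le_trans.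
have gap0 k : (k < 2 * K)%N -> 0 <= v k - eps / (2 * l k).
  move=> kK; have lk := l0 k kK; have := lv k kK.
  rewrite subr_ge0 ler_pdivrMr ?mulr_gt0 // => H; nra.
have FK i : D <= F K i - Fy i.
  have : D <= \sum_(K <= k < 2 * K) (- F k.+1 i - - F k i).
    apply: ler_sum_nat => k /andP[_ kK]; have := desc k i kK; lra.
  rewrite telescope_sumr //; have := below i; lra.
have mono k i : (k <= K)%N -> F K i <= F k i.
  move=> kK; have : 0 <= \sum_(k <= s < K) (- F s.+1 i - - F s i).
    rewrite big_nat; apply: sumr_ge0 => s /andP[_ sK].
    have sK2 : (s < 2 * K)%N by apply: leq_trans K2.
    have := desc s i sK2; have := gap0 s sK2; lra.
  by rewrite telescope_sumr //; lra.
have step k : (k < K)%N -> (l k)^-1 * (2 * D - eps) <= - r k.+1 - - r k.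
  move=> kK; have kK2 : (k < 2 * K)%N by apply: leq_trans K2.
  have lk := l0 k kK2; have l1k := l1 k kK2.
  have := prox k (D + (v k - eps / (2 * l k))) kK2.
  have Fe i : D + (v k - eps / (2 * l k)) <= F k i - Fy i.
    have := desc k i kK2; have := mono k.+1 i kK; have := FK i; lra.
  move=> /(_ Fe).
  have -> : eps / (2 * l k) = eps * (l k)^-1 / 2 by field; rewrite gt_eqF.
  rewrite ler_pdivrMl //.
  have il1 : eps * (l k)^-1 <= eps.
    by apply: ler_piMr; [exact: ltW|rewrite invf_le1].
  lra.
rewrite mulr_suml.
have := ler_sum_nat (fun k (H : (0 <= k < K)%N) => step k (andP H).2).
rewrite telescope_sumr //; lra.
Qed.

(** The strictness matters: the squared distances to the points y only bound
    their infimum from below, so the contradiction needs a strict gap that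
    does not depend on y. *)
Lemma two_phase_gain (K : nat) (l v : nat -> R) (L eps : R) :
  0 < eps -> (0 < K)%N -> 2 * L <= K%:R ->
  (forall k, (k < 2 * K)%N -> 1 <= l k <= L) ->
  (forall k, (k < 2 * K)%N -> eps < l k * v k) ->
  K%:R ^+ 2 * eps / (2 * L ^+ 2) <
  (\sum_(0 <= k < K) (l k)^-1) *
    (2 * (\sum_(K <= k < 2 * K) (v k - eps / (2 * l k))) - eps).
Proof.
move=> e0 K0 LK l1L lv.
have K2 : (K <= 2 * K)%N by rewrite leq_pmull.
have K0R : 0 < K%:R :> R by rewrite ltr0n.
have L1 : 1 <= L.
  have /l1L/andP[] : (0 < 2 * K)%N by rewrite muln_gt0.
  exact: le_trans.
have L0 : 0 < L by apply: lt_le_trans L1.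
have S : K%:R / L <= \sum_(0 <= k < K) (l k)^-1.
  have -> : K%:R / L = \sum_(0 <= k < K) L^-1.
    by rewrite sumr_const_nat subn0 mulr_natl.
  apply: ler_sum_nat => k /andP[_ kK].
  have /l1L/andP[l1 lL] : (k < 2 * K)%N by apply: leq_trans K2.
  by rewrite lef_pV2 // posrE (lt_le_trans _ l1).
have D : K%:R * (eps / (2 * L)) < \sum_(K <= k < 2 * K) (v k - eps / (2 * l k)).
  have -> : K%:R * (eps / (2 * L)) = \sum_(K <= k < 2 * K) (eps / (2 * L)).
    by rewrite sumr_const_nat mul2n -addnn addnK mulr_natl.
  apply: ltr_sum_nat; first by rewrite mul2n -addnn -[ltnLHS]addn0 ltn_add2l.
  move=> k /andP[_ kK].
  have /andP[l1 lL] := l1L k kK; have lk : 0 < l k by apply: lt_le_trans l1.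
  apply: (@le_lt_trans _ _ (eps / (2 * l k))).
    by rewrite ler_pM2l // lef_pV2 ?posrE ?mulr_gt0 // ler_pM2l.
  have := lv k kK; rewrite mulrC -ltr_pdivrMr //.
  have -> : eps / l k = eps / (2 * l k) + eps / (2 * l k).
    by field; rewrite gt_eqF.
  lra.
set Delta := \sum_(K <= k < 2 * K) _ in D *.
have G : K%:R * (eps / (2 * L)) < 2 * Delta - eps.
  have : eps <= K%:R * (eps / (2 * L)).
    by rewrite mulrA ler_pdivlMr ?mulr_gt0 // mulrC ler_wpM2r // ltW.
  lra.
have KL0 : 0 < K%:R / L by rewrite divr_gt0.
have E0 : 0 < K%:R * (eps / (2 * L)).
  by rewrite mulr_gt0 // divr_gt0 // mulr_gt0.
have -> : K%:R ^+ 2 * eps / (2 * L ^+ 2) = K%:R / L * (K%:R * (eps / (2 * L))).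
  by field; rewrite gt_eqF.
apply: (@lt_le_trans _ _ (K%:R / L * (2 * Delta - eps))).
  by rewrite ltr_pM2l.
by rewrite ler_wpM2r // ltW // (lt_trans E0).
Qed.

End Rate.

(** * The backtracking method *)

Section Method.
Context {R : realType} {m n : nat}.
Variables (f : 'I_m -> 'rV[R]_n -> R) (g : 'I_m -> 'rV[R]_n -> \bar R).
Variables (nu M : 'I_m -> R).
Hypothesis m_gt0 : (0 < m)%N.
Hypothesis f_diff : forall i x, differentiable (f i) x.
Hypothesis g_proper : forall i, proper_function (g i).
Hypothesis g_lsc : forall i, lower_semicontinuous (g i).
Hypothesis g_convex : forall i, econvex (g i).
Hypothesis nu01 : forall i, 0 < nu i <= 1.
Hypothesis M_gt0 : forall i, 0 < M i.
Hypothesis f_holder : forall i x y, domain f g x -> domain f g y ->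
  enorm (gradient (f i) x - gradient (f i) y) <= M i * enorm (x - y) `^ nu i.
Hypothesis f_convex : forall i,
  convex_function (setT : set (convex_lmodType 'rV[R]_n)) (f i).

Definition value (x : 'rV[R]_n) (i : 'I_m) : R := f i x + fine (g i x).

Lemma objective_value x i : domain f g x -> objective f g x i = (value x i)%:E.
Proof. by move=> Dx; rewrite /objective (domain_fine g_proper i Dx) EFinD. Qed.

Lemma domain_segment x y t : 0 <= t <= 1 -> domain f g x -> domain f g y ->
  domain f g (t *: x + (1 - t) *: y).
Proof.
move=> t01 Dx Dy; apply/(domainP f g_proper) => i.
have gx : (g i x <= (fine (g i x))%:E)%E.
  by rewrite -(domain_fine g_proper i Dx).
have gy : (g i y <= (fine (g i y))%:E)%E.
  by rewrite -(domain_fine g_proper i Dy).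
by apply: le_lt_trans (econvex_le g_convex t01 gx gy) _; rewrite ltry.
Qed.

(** The subproblem value - w already contains l / 2 |d|^2, and the Hoelder
    remainder exceeds it by at most eps / (2 l). The segment from x to x + d
    stays in the domain, which is where the gradients are Hoelder continuous. *)
Lemma accepted_above_threshold eps x l : 0 < eps -> 0 < l ->
  bigN nu M eps <= l -> domain f g x -> accepted f g eps x l.
Proof.
move=> e0 l0 Nl Dx i.
have [v [mE + _]] := prox_step g_proper g_lsc g_convex m_gt0 l0 Dx.
set p := direction f g l x => sp.
have Dxp := subproblem_domain g_proper Dx sp.
rewrite !objective_value // mE -EFinB -EFinN -EFinD lee_fin /value.
have /(_ i) := (subproblem_leP g_proper l p (- v) Dx).1 sp.
rewrite (domain_fine g_proper i Dxp) lee_fin => gp.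
have /andP[nu0 nu1] := nu01 i.
have hol (t : R) : 0 < t < 1 ->
    enorm (gradient (f i) (x + t *: p) - gradient (f i) x)
      <= M i * enorm (t *: p) `^ nu i.
  move=> /andP[t0 t1]; have t01 : 0 <= t <= 1 by rewrite !ltW.
  have xE : x + t *: p = t *: (x + p) + (1 - t) *: x.
    by apply/rowP => j; rewrite !mxE; ring.
  have := @f_holder i (x + t *: p) x; rewrite [x + _]addrC addrK; apply=> //.
  by rewrite addrC xE; exact: domain_segment.
have := holder_descent (f_diff i) nu0 hol.
have thr : holder_threshold (nu i) (M i) eps <= l.
  apply: le_trans Nl.
  exact: (le_bigmax 0 (fun i => holder_threshold (nu i) (M i) eps)).
have := holder_young (nu01 i) (M_gt0 i) e0 l0 (enorm_ge0 p) thr.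
lra.
Qed.

Lemma trial_ge1 lp j : 1 <= trial lp j :> R.
Proof.
have p1 : 1 <= Num.max 1 (lp / 2) by rewrite le_max lexx.
rewrite /trial (le_trans p1) // ler_peMl ?(le_trans _ p1) //.
by rewrite exprn_ege1 // ler1n.
Qed.

Section Run.
Variables (eps : R) (x0 : 'rV[R]_n) (lm1 : R).
Variables (x : nat -> 'rV[R]_n) (l : nat -> R).
Hypothesis eps_gt0 : 0 < eps.
Hypothesis x0_dom : domain f g x0.
Hypothesis lm1_ge2 : 2 <= lm1.
Hypothesis run : algorithm_run f g eps x0 lm1 x l.

Lemma run_ge1 k : 1 <= l k.
Proof. by have [_ /(_ k)[j [-> _ _ _]]] := run; exact: trial_ge1. Qed.

Lemma run_gt0 k : 0 < l k.
Proof. exact: lt_le_trans (run_ge1 k). Qed.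

Lemma run_domain k : domain f g (x k).
Proof.
have [x0E step] := run; elim: k => [|k IH]; first by rewrite x0E.
have [j [_ _ _ ->]] := step k.
have [v [_ sp _]] := prox_step g_proper g_lsc g_convex m_gt0 (run_gt0 k) IH.
exact: subproblem_domain sp.
Qed.

(** Either the first trial value, which is 1 or half of the previous one, is
    accepted, or the value l_k / 2 was rejected and is therefore below N. *)
Lemma run_le k : l k <= Num.max lm1 (2 * bigN nu M eps).
Proof.
set L := Num.max _ _; have L2 : 2 <= L by rewrite le_max lm1_ge2.
have [_ step] := run.
have next k' : previous lm1 l k' <= L -> l k' <= L.
  move=> pL; have [[|j] [-> _ rej _]] := step k'.
    by rewrite /trial expr0 mul1r ge_max; apply/andP; split; lra.
  have := rej j (ltnSn j); set t := trial _ j => nacc.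
  have t0 : 0 < t := lt_le_trans ltr01 (trial_ge1 _ _).
  have tN : t < bigN nu M eps.
    rewrite ltNge; apply/negP => Nt; apply: nacc.
    by apply: accepted_above_threshold => //; exact: run_domain.
  have -> : trial (previous lm1 l k') j.+1 = 2 * t.
    by rewrite /t /trial exprS mulrA.
  by rewrite le_max; apply/orP; right; lra.
elim: k => [|k IH]; apply: next => //=.
by rewrite le_max lexx.
Qed.

(** The decrease is the acceptance test; for the proximal inequality,
    convexity of f_i bounds the linearization at x^k by the values F_i(x^k) -
    F_i(y). *)
Lemma run_step k : exists v : R,
  [/\ merit f g (l k) (x k) = v%:E,
      forall i, value (x k.+1) i <= value (x k) i - v + eps / (2 * l k) &
      forall y e, domain f g y -> (forall i, e <= value (x k) i - value y i) ->
        e <= v + l k / 2 * (enorm (y - x k) ^+ 2 - enorm (y - x k.+1) ^+ 2)].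
Proof.
have [_ step] := run; have [j [_ acc _ xE]] := step k.
have Dx := run_domain k; have Dx' := run_domain k.+1; have l0 := run_gt0 k.
have [v [mE _ three]] := prox_step g_proper g_lsc g_convex m_gt0 l0 Dx.
exists v; split=> // [i|y e Dy He].
  have := acc i; rewrite -xE !objective_value // mE.
  by rewrite -EFinB -EFinN -EFinD lee_fin; lra.
have := three (y - x k) (- e + l k / 2 * enorm (y - x k) ^+ 2).
rewrite -addrA -opprD -xE => /(_ _) H.
suff /H : (subproblem f g (l k) (x k) (y - x k) <=
    (- e + l k / 2 * enorm (y - x k) ^+ 2)%:E)%E by lra.
apply/(subproblem_leP g_proper) => // i.
rewrite addrC subrK (domain_fine g_proper i Dy) lee_fin.
have := convex_above_tangent y (f_convex i) (f_diff i (x k)).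
have := He i; rewrite /value; lra.
Qed.

End Run.
End Method.

(** * Asymptotics of the iteration bound *)

Section Asymptotics.
Context {R : realType} {m : nat}.
Variables (nu M : 'I_m -> R).
Hypothesis nu01 : forall i, 0 < nu i <= 1.

Lemma nu_min_gt0 : 0 < nu_min nu.
Proof.
rewrite /nu_min; elim/big_ind : _ => // [a b a0 b0|i _].
  by rewrite lt_min a0.
by have /andP[] := nu01 i.
Qed.

Lemma nu_min_le i : nu_min nu <= nu i.
Proof. exact: bigmin_le. Qed.

Lemma holder_threshold_scaling (a b eps : R) : 0 < a <= 1 -> 0 < eps ->
  holder_threshold a b eps =
  holder_threshold a b 1 * (eps^-1) `^ ((1 - a) / (2 * a)).
Proof.
move=> /andP[a0 a1] e0; rewrite /holder_threshold divr1 mulr1.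
rewrite powRM; last 2 first.
- by rewrite divr_ge0 ?subr_ge0 // addr_ge0 // ltW.
- by rewrite divr_ge0 // ltW.
by rewrite div1r mulrAC.
Qed.

(** The exponent is 1 / (2 nu_i) - 1 / 2, a decreasing function of nu_i. *)
Lemma holder_exponent_le i :
  (1 - nu i) / (2 * nu i) <= (1 - nu_min nu) / (2 * nu_min nu).
Proof.
have n0 := nu_min_gt0; have nle := nu_min_le i.
have i0 : 0 < nu i by apply: lt_le_trans nle.
rewrite ler_pdivrMr ?mulr_gt0 // mulrAC ler_pdivlMr ?mulr_gt0 //; nra.
Qed.

Lemma bigN_growth eps : 0 < eps <= 1 ->
  bigN nu M eps <=
  bigN nu M 1 * (eps^-1) `^ ((1 - nu_min nu) / (2 * nu_min nu)).
Proof.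
move=> /andP[e0 e1].
have T0 := powR_ge0 (eps^-1) ((1 - nu_min nu) / (2 * nu_min nu)).
apply/bigmax_leP; split.
  by rewrite mulr_ge0 //; exact: bigmax_ge_id.
move=> i _; rewrite -/(holder_threshold (nu i) (M i) eps).
rewrite holder_threshold_scaling //.
apply: ler_pM.
- by rewrite mulr_ge0 ?powR_ge0.
- exact: powR_ge0.
- exact: (le_bigmax 0 (fun i => holder_threshold (nu i) (M i) 1)).
- by apply: ler_powR; [rewrite invf_ge1|exact: holder_exponent_le].
Qed.

(** For eps <= 1 the powers of 1 / eps are at least 1, so each maximum is at
    most the sum of the values of its arguments at eps = 1, times the relevant
    power; the exponents 1 / (2 nu_min) - 1 / 2 and 1 / 2 add up. *)
Lemma iteration_bound_bigO (lm1 rad : R) : 2 <= lm1 ->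
  (fun eps : R => iteration_bound nu M lm1 rad eps : R^o)
    =O_ (0^'+) (fun eps : R => eps `^ (- (1 / (2 * nu_min nu))) : R^o).
Proof.
move=> lm1_ge2; set C := lm1 + 2 * bigN nu M 1.
set D := 4 + 2 * Num.sqrt (2 * rad).
have N0 : 0 <= bigN nu M 1 by exact: bigmax_ge_id.
have S0 : 0 <= Num.sqrt (2 * rad) by exact: sqrtr_ge0.
have C0 : 0 < C by rewrite /C; lra.
have D0 : 0 < D by rewrite /D; lra.
apply/eqO_exP; exists (C * D); first exact: mulr_gt0.
near=> e.
have e0 : 0 < e by near: e; exact: nbhs_right_gt.
have e1 : e <= 1 by near: e; exact: nbhs_right_le.
have n0 := nu_min_gt0.
set q := (1 - nu_min nu) / (2 * nu_min nu).
have q0 : 0 <= q.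
  have [i _|] := pickP 'I_m; last first.
    move=> m0; rewrite /q /nu_min big_pred0 ?subrr ?mul0r //.
  rewrite divr_ge0 ?mulr_ge0 ?(ltW n0) // subr_ge0.
  by apply: le_trans (nu_min_le i) _; have /andP[] := nu01 i.
have ie1 : 1 <= e^-1 by rewrite invf_ge1.
have T1 : 1 <= (e^-1) `^ q by rewrite -(powRr0 e^-1); exact: ler_powR.
have s0 : 0 < Num.sqrt e by rewrite sqrtr_gt0.
have s1 : 1 <= (Num.sqrt e)^-1.
  by rewrite invf_ge1 // -[leRHS]sqrtr1 ler_sqrt.
have -> : e `^ (- (1 / (2 * nu_min nu))) = (e^-1) `^ q * (Num.sqrt e)^-1.
  rewrite -powR12_sqrt ?(ltW e0) // -(powR_inv1 (ltW e0)) -powRrM -powRN -powRD.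
    by congr (_ `^ _); rewrite /q; field; rewrite gt_eqF.
  by rewrite (gt_eqF e0) /= implybT.
rewrite !ger0_norm ?mulr_ge0 ?powR_ge0 ?invr_ge0 ?(ltW s0) //; last first.
  by rewrite le_max; apply/orP; left; lra.
rewrite /iteration_bound mulrACA; apply: ler_pM.
- by rewrite le_max; apply/orP; left; lra.
- by rewrite le_max; apply/orP; left.
- have := @bigN_growth e; rewrite e0 e1 => /(_ isT); rewrite -/q => Nq.
  have lT : lm1 <= lm1 * (e^-1) `^ q by rewrite ler_peMr //; lra.
  have NT : 0 <= bigN nu M 1 * (e^-1) `^ q by rewrite mulr_ge0 // powR_ge0.
  by rewrite ge_max /C; apply/andP; split; lra.
- set s := (Num.sqrt e)^-1 in s1 *.
  have Ss : 0 <= Num.sqrt (2 * rad) * s by rewrite mulr_ge0 // (le_trans ler01).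
  by rewrite ge_max /D; apply/andP; split; lra.
Unshelve. all: by end_near. Qed.

End Asymptotics.

(** * Iteration complexity *)

Theorem theorem3p2 (R : realType) (m n : nat) (hm : (1 <= m)%N) (hn : (1 <= n)%N)
    (f : 'I_m -> 'rV[R]_n -> R) (g : 'I_m -> 'rV[R]_n -> \bar R)
    (nu M : 'I_m -> R)
    (hf : forall i, continuously_differentiable (f i))
    (hg : forall i, [/\ proper_function (g i), lower_semicontinuous (g i) & econvex (g i)])
    (hnu : forall i, 0 < nu i <= 1)
    (hM : forall i, 0 < M i)
    (hHolder : forall i x y, domain f g x -> domain f g y ->
       enorm (gradient (f i) x - gradient (f i) y)
         <= M i * enorm (x - y) `^ nu i)
    (hconv : forall i, convex_function (setT : set (convex_lmodType 'rV[R]_n)) (f i))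
    (x0 : 'rV[R]_n) (hx0 : domain f g x0)
    (lm1 : R) (hlm1 : 2 <= lm1)
    (hi : forall x, level_set f g (objective f g x0) x ->
       exists2 xs, weakly_pareto f g xs &
         forall i, (objective f g xs i <= objective f g x i)%E)
    (hii : (solution_radius f g x0 < +oo)%E) :
  (forall (eps : R) (x : nat -> 'rV[R]_n) (l : nat -> R) (K : nat),
      0 < eps ->
      algorithm_run f g eps x0 lm1 x l ->
      (0 < K)%N ->
      iteration_bound nu M lm1 (fine (solution_radius f g x0)) eps <= (2 * K)%:R ->
      (\big[mine/+oo]_(k < 2 * K) ((l k)%:E * merit f g (l k) (x k)) <= eps%:E)%E)
  /\
  (fun eps : R => iteration_bound nu M lm1 (fine (solution_radius f g x0)) eps : R^o)
    =O_ (0^'+) (fun eps : R => eps `^ (- (1 / (2 * nu_min nu))) : R^o).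
Proof.
have fd i x : differentiable (f i) x by have [] := hf i.
have gp i : proper_function (g i) by have [] := hg i.
have gl i : lower_semicontinuous (g i) by have [] := hg i.
have gc i : econvex (g i) by have [] := hg i.
split; last exact: iteration_bound_bigO.
move=> eps x l K e0 run K0 bound; rewrite leNgt; apply/negP => big.
have Dx k : domain f g (x k) by exact: (run_domain hm gp gl gc hx0 run).
have l1 k : 1 <= l k by exact: (run_ge1 run).
have lL k : l k <= Num.max lm1 (2 * bigN nu M eps).
  exact: (run_le hm fd gp gl gc hnu hM hHolder e0 hx0 hlm1 run).
have [v vP] := choice (run_step hm fd gp gl gc hconv hx0 run).
have lv k : (k < 2 * K)%N -> eps < l k * v k.
  move=> kK; have [mE _ _] := vP k.
  have := lt_le_trans big (bigmin_le +oo%E (Ordinal kK)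
    (fun k : 'I_(2 * K) => ((l k)%:E * merit f g (l k) (x k))%E)).
  by rewrite /= mE -EFinM lte_fin.
have desc k i : (k < 2 * K)%N ->
    value f g (x k.+1) i <= value f g (x k) i - v k + eps / (2 * l k).
  by have [_ + _] := vP k; exact.
have decr k i : (k <= 2 * K)%N -> value f g (x k) i <= value f g x0 i.
  elim: k => [|k IH] kK; first by have [-> _] := run.
  apply: le_trans (IH (ltnW kK)); apply: le_trans (desc k i kK) _.
  have := lv k kK; have lk : 0 < l k by apply: lt_le_trans (l1 k).
  rewrite -ltr_pdivrMl // mulrC => ev.
  have -> : eps / (2 * l k) = eps / l k / 2 by field; rewrite gt_eqF.
  have : 0 < eps / l k by rewrite divr_gt0.
  lra.
have lev : level_set f g (objective f g x0) (x (2 * K)%N).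
  by move=> i /=; rewrite !objective_value // lee_fin; exact: decr.
have [xs xs_opt xs_le] := hi _ lev.
have Dxs : domain f g xs by case: xs_opt.
pose S := \sum_(0 <= k < K) (l k)^-1.
pose Delta := \sum_(K <= k < 2 * K) (v k - eps / (2 * l k)).
have fiber y : objective f g y = objective f g xs ->
    S * (2 * Delta - eps) <= enorm (y - x0) ^+ 2.
  move=> yE; have Dy : domain f g y by rewrite /domain /= yE.
  have <- : x 0%N = x0 by case: run.
  apply: (two_phase_rate (F := fun k => value f g (x k)) (Fy := value f g y)
    (r := fun k => enorm (y - x k) ^+ 2)) => //.
  - move=> i; rewrite -lee_fin -!objective_value // yE; exact: xs_le.
  - by move=> k e kK He; have [_ _] := vP k; apply.
  - exact: sqr_ge0.
have gain : K%:R ^+ 2 * eps / (2 * (Num.max lm1 (2 * bigN nu M eps)) ^+ 2)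
    < S * (2 * Delta - eps).
  apply: two_phase_gain => //; last by move=> k _; rewrite l1 lL.
  have L0 : 0 <= Num.max lm1 (2 * bigN nu M eps).
    by rewrite le_max; apply/orP; left; lra.
  move: bound; rewrite /iteration_bound natrM => bound.
  suff : Num.max lm1 (2 * bigN nu M eps) * 4 <= 2 * K%:R by lra.
  by apply: le_trans bound; rewrite ler_wpM2l // le_max lexx.
set L := Num.max lm1 (2 * bigN nu M eps) in gain bound lL *.
have L0 : 0 < L by rewrite lt_max; apply/orP; left; lra.
have Gpos : 0 < S * (2 * Delta - eps).
  by apply: le_lt_trans gain; rewrite divr_ge0 ?mulr_ge0 ?sqr_ge0 // ltW.
have radius : ((S * (2 * Delta - eps))%:E <= solution_radius f g x0)%E.
  apply: (@le_trans _ _ (ereal_inf [set (enorm (x - x0) ^+ 2)%:E |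
      x in objective f g @^-1` [set objective f g xs]])).
    by apply: le_ereal_inf_tmp => _ [y /= yE <-]; rewrite lee_fin; exact: fiber.
  apply: ereal_sup_ubound; exists (objective f g xs) => //.
  exists xs => //; split => // i /=.
  by apply: le_trans (xs_le i) (lev i).
have radius_fin : solution_radius f g x0 = (fine (solution_radius f g x0))%:E.
  by move: radius hii; case: (solution_radius f g x0).
move: radius; rewrite radius_fin lee_fin; set r := fine _ in bound * => rad.
suff : r <= K%:R ^+ 2 * eps / (2 * L ^+ 2) by lra.
have r0 : 0 <= r by lra.
have s0 : 0 < Num.sqrt eps by rewrite sqrtr_gt0.
have : L * (2 * Num.sqrt (2 * r) / Num.sqrt eps) <= 2 * K%:R.
  rewrite -natrM; apply: le_trans bound; rewrite ler_wpM2l ?(ltW L0) //.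
  by rewrite le_max lexx orbT.
rewrite mulrA ler_pdivrMr // => H.
have {}H : L * Num.sqrt (2 * r) <= K%:R * Num.sqrt eps by lra.
have : (L * Num.sqrt (2 * r)) ^+ 2 <= (K%:R * Num.sqrt eps) ^+ 2.
  by rewrite ler_pXn2r // nnegrE mulr_ge0 ?sqrtr_ge0 // ltW.
rewrite !exprMn !sqr_sqrtr ?(ltW e0) ?mulr_ge0 // => H2.
by rewrite ler_pdivlMr ?mulr_gt0 ?exprn_gt0 //; lra.
Qed.
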